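(* Let $(A,\cdot,\{~,~\})$ be a Poisson algebra, $(V,\mu,\rho)$ a representation of it, $(h,H)$ a Poisson $2$-cocycle of $(A,\cdot,\{~,~\})$ with coefficients in the representation $V$, and let $R:V\to A$ be an $(h,H)$-twisted Rota-Baxter operator on $(A,\cdot,\{~,~\})$ with respect to the representation $V$. Then the quintuple $(V,\ast,\curlyvee,\diamond,\bullet)$ is an NS-Poisson algebra, where $$u\ast v:=\mu_{R(u)}v,\quad u\curlyvee v:=h(R(u),R(v)),\quad u\diamond v:=\rho_{R(u)}v,\quad u\bullet v:=H(R(u),R(v)),\qquad u,v\in V.$$
   Context: All vector spaces and (multi)linear maps are over a field $\mathbf{k}$ of characteristic $0$. Associative algebras are not required to be unital. A Poisson algebra is a triple $(A,\cdot,\{~,~\})$ with $(A,\cdot)$ a commutative associative algebra and $\{~,~\}$ a Lie bracket on $A$ satisfying $\{x,y\cdot z\}=\{x,y\}\cdot z+y\cdot\{x,z\}$. A representation of a Poisson algebra $(A,\cdot,\{~,~\})$ is a triple $(V,\mu,\rho)$ where $(V,\mu)$ is a representation of the commutative associative algebra $(A,\cdot)$ (i.e. $\mu:A\to\mathrm{End}(V)$ is linear with $\mu_{x\cdot y}=\mu_x\circ\mu_y$), $(V,\rho)$ is a representation of the Lie algebra $(A,\{~,~\})$, and for all $x,y\in A$: $\rho_x\circ\mu_y-\mu_y\circ\rho_x-\mu_{\{x,y\}}=0$ and $\mu_x\circ\rho_y+\mu_y\circ\rho_x-\rho_{x\cdot y}=0$. A Poisson $2$-cocycle of $(A,\cdot,\{~,~\})$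 with coefficients in $(V,\mu,\rho)$ is a pair $(h,H)$ with $h\in\mathrm{Hom}(A^{\otimes 2},V)$ and $H\in\mathrm{Hom}(\wedge^2A,V)$ such that for all $x,y,z\in A$: $$h(x,y)=h(y,x),\qquad \mu_xh(y,z)+h(x,y\cdot z)=\mu_yh(x,z)+h(y,x\cdot z),$$ $$\rho_xH(y,z)+\rho_yH(z,x)+\rho_zH(x,y)+H(x,\{y,z\})+H(y,\{z,x\})+H(z,\{x,y\})=0,$$ $$H(x,y\cdot z)+\rho_xh(y,z)=h(\{x,y\},z)+\mu_zH(x,y)+h(y,\{x,z\})+\mu_yH(x,z).$$ A linear map $R:V\to A$ is an $(h,H)$-twisted Rota-Baxter operator with respect to $V$ if for all $u,v\in V$: $$R(u)\cdot R(v)=R\big(\mu_{R(u)}v+\mu_{R(v)}u+h(R(u),R(v))\big),\qquad \{R(u),R(v)\}=R\big(\rho_{R(u)}v-\rho_{R(v)}u+H(R(u),R(v))\big).$$ An NS-commutative algebra is a triple $(B,\ast,\curlyvee)$ of a vector space $B$ with bilinear operations $\ast,\curlyvee$, where $\curlyvee$ is commutative, such that for all $x,y,z\in B$, with $x\odot y=x\ast y+y\ast x+x\curlyvee y$: $$x\ast(y\ast z)=(x\odot y)\ast z,\qquad x\ast(y\curlyvee z)+x\curlyvee(y\odot z)=y\ast(x\curlyvee z)+y\curlyvee(x\odot z).$$ An NS-Lie algebra is a triple $(B,\diamond,\bullet)$ of a vector space $B$ with bilinear operations $\diamond,\bullet$, where $\bullet$ is skew-symmetric, such that for all $x,y,z\in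 B$, with $\{\!\!\{x,y\}\!\!\}=x\diamond y-y\diamond x+x\bullet y$: $$x\diamond(y\diamond z)-(x\diamond y)\diamond z-y\diamond(x\diamond z)+(y\diamond x)\diamond z=(x\bullet y)\diamond z,$$ $$x\bullet\{\!\!\{y,z\}\!\!\}+y\bullet\{\!\!\{z,x\}\!\!\}+z\bullet\{\!\!\{x,y\}\!\!\}+x\diamond(y\bullet z)+y\diamond(z\bullet x)+z\diamond(x\bullet y)=0.$$ An NS-Poisson algebra is a quintuple $(B,\ast,\curlyvee,\diamond,\bullet)$ such that $(B,\ast,\curlyvee)$ is an NS-commutative algebra, $(B,\diamond,\bullet)$ is an NS-Lie algebra, and for all $x,y,z\in B$, with $x\odot y=x\ast y+y\ast x+x\curlyvee y$ and $\{\!\!\{x,y\}\!\!\}=x\diamond y-y\diamond x+x\bullet y$: $$\{\!\!\{x,y\}\!\!\}\ast z=x\diamond(y\ast z)-y\ast(x\diamond z),$$ $$(x\odot y)\diamond z=x\ast(y\diamond z)+y\ast(x\diamond z),$$ $$x\bullet(y\odot z)+x\diamond(y\curlyvee z)=\{\!\!\{x,y\}\!\!\}\curlyvee z+z\ast(x\bullet y)+y\curlyvee\{\!\!\{x,z\}\!\!\}+y\ast(x\bullet z).$$ *)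

(* Defs.v *)
From mathcomp Require Import all_boot all_order all_algebra.
Set Implicit Arguments.
Unset Strict Implicit.
Unset Printing Implicit Defensive.
Import GRing.Theory.
Local Open Scope ring_scope.

(* Structures are stated as predicates on plain functions, so that no unit for
   the products and no finite dimension for the spaces is assumed.  A linear
   map out of a tensor product U (x) V is a bilinear map on U and V; is_bilinear
   is the Prop-valued form of the library's bilinear_for *:%R *:%R. *)
Definition is_bilinear (k : fieldType) (U V W : lmodType k)
    (f : U -> V -> W) : Prop :=
  (forall v : V, linear (fun u : U => f u v)) /\
  (forall u : U, linear (fun v : V => f u v)).

Section Poisson.
Variables (k : fieldType) (A : lmodType k).
Implicit Types mul br : A -> A -> A.

Record comm_assoc_algebra mul : Prop := {
  caa_bilinear : is_bilinear mul;
  caa_comm : commutative mul;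
  caa_assoc : associative mul }.

Record lie_algebra br : Prop := {
  lie_bilinear : is_bilinear br;
  lie_alternating : forall x, br x x = 0;
  lie_jacobi : forall x y z,
    br x (br y z) + br y (br z x) + br z (br x y) = 0 }.

Record poisson_algebra mul br : Prop := {
  pa_comm_assoc : comm_assoc_algebra mul;
  pa_lie : lie_algebra br;
  pa_leibniz : forall x y z,
    br x (mul y z) = mul (br x y) z + mul y (br x z) }.

Variable V : lmodType k.
Implicit Types mu rho : A -> V -> V.

(* A linear map from A to End(V) is encoded as a bilinear action of A on V. *)
Record comm_assoc_representation mul mu : Prop := {
  car_bilinear : is_bilinear mu;
  car_mul : forall x y v, mu (mul x y) v = mu x (mu y v) }.

Record lie_representation br rho : Prop := {
  lr_bilinear : is_bilinear rho;
  lr_bracket : forall x y v,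
    rho (br x y) v = rho x (rho y v) - rho y (rho x v) }.

Record poisson_representation mul br mu rho : Prop := {
  pr_comm_assoc : comm_assoc_representation mul mu;
  pr_lie : lie_representation br rho;
  pr_compat_bracket : forall x y v,
    rho x (mu y v) - mu y (rho x v) - mu (br x y) v = 0;
  pr_compat_mul : forall x y v,
    mu x (rho y v) + mu y (rho x v) - rho (mul x y) v = 0 }.

(* pc_H_bilinear and pc_H_alternating together say that H is a linear map on
   the exterior square of A. *)
Record poisson_2cocycle mul br mu rho (h H : A -> A -> V) : Prop := {
  pc_h_bilinear : is_bilinear h;
  pc_H_bilinear : is_bilinear H;
  pc_H_alternating : forall x, H x x = 0;
  pc_h_sym : forall x y, h x y = h y x;
  pc_h_cocycle : forall x y z,
    mu x (h y z) + h x (mul y z) = mu y (h x z) + h y (mul x z);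
  pc_H_cocycle : forall x y z,
    rho x (H y z) + rho y (H z x) + rho z (H x y)
      + H x (br y z) + H y (br z x) + H z (br x y) = 0;
  pc_compat : forall x y z,
    H x (mul y z) + rho x (h y z)
      = h (br x y) z + mu z (H x y) + h y (br x z) + mu y (H x z) }.

Record twisted_rota_baxter mul br mu rho (h H : A -> A -> V) (R : V -> A)
    : Prop := {
  trb_linear : linear R;
  trb_mul : forall u v,
    mul (R u) (R v) = R (mu (R u) v + mu (R v) u + h (R u) (R v));
  trb_bracket : forall u v,
    br (R u) (R v) = R (rho (R u) v - rho (R v) u + H (R u) (R v)) }.

End Poisson.

Section NSPoisson.
Variables (k : fieldType) (B : lmodType k).
Implicit Types ast vee dia bul : B -> B -> B.

Definition ns_odot ast vee (x y : B) : B := ast x y + ast y x + vee x y.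

Definition ns_bracket dia bul (x y : B) : B := dia x y - dia y x + bul x y.

Record ns_commutative_algebra ast vee : Prop := {
  nsc_ast_bilinear : is_bilinear ast;
  nsc_vee_bilinear : is_bilinear vee;
  nsc_vee_comm : commutative vee;
  nsc_ast_ast : forall x y z, ast x (ast y z) = ast (ns_odot ast vee x y) z;
  nsc_ast_vee : forall x y z,
    ast x (vee y z) + vee x (ns_odot ast vee y z)
      = ast y (vee x z) + vee y (ns_odot ast vee x z) }.

Record ns_lie_algebra dia bul : Prop := {
  nsl_dia_bilinear : is_bilinear dia;
  nsl_bul_bilinear : is_bilinear bul;
  nsl_bul_skew : forall x y, bul x y = - bul y x;
  nsl_dia_dia : forall x y z,
    dia x (dia y z) - dia (dia x y) z - dia y (dia x z) + dia (dia y x) z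
      = dia (bul x y) z;
  nsl_cyclic : forall x y z,
    bul x (ns_bracket dia bul y z) + bul y (ns_bracket dia bul z x)
      + bul z (ns_bracket dia bul x y)
      + dia x (bul y z) + dia y (bul z x) + dia z (bul x y) = 0 }.

Record ns_poisson_algebra ast vee dia bul : Prop := {
  nsp_comm : ns_commutative_algebra ast vee;
  nsp_lie : ns_lie_algebra dia bul;
  nsp_bracket_ast : forall x y z,
    ast (ns_bracket dia bul x y) z = dia x (ast y z) - ast y (dia x z);
  nsp_odot_dia : forall x y z,
    dia (ns_odot ast vee x y) z = ast x (dia y z) + ast y (dia x z);
  nsp_bul_odot : forall x y z,
    bul x (ns_odot ast vee y z) + dia x (vee y z)
      = vee (ns_bracket dia bul x y) z + ast z (bul x y)
        + vee y (ns_bracket dia bul x z) + ast y (bul x z) }.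

End NSPoisson.

(* Main.v *)
Require Import Defs.
From mathcomp Require Import all_boot all_order all_algebra.
Set Implicit Arguments.
Unset Strict Implicit.
Import GRing.Theory.
Local Open Scope ring_scope.

(** The two defining identities of a twisted Rota-Baxter operator say exactly
    that R turns the derived operations of the quintuple into the operations
    of A: R (u (.) v) = R u . R v and R {{u, v}} = {R u, R v}, where (.) and
    {{ , }} are [ns_odot] and [ns_bracket].  The operations of the quintuple
    are mu, h, rho and H with their A-slots fed through R, so an NS axiom in
    which (.) and {{ , }} occur only in such slots becomes, after this
    replacement, an axiom of the representation or of the cocycle evaluated at
    R x, R y, R z.

    The first NS-Lie axiom has its bracket already expanded.  The linearity of
    u |-> rho (R u) z reassembles the three terms of {{x, y}}, and what
    remains is that rho sends the bracket {R x, R y} to the commutator of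
    rho (R x) and rho (R y) ([rep_bracket_dia_dia]). *)

Lemma is_bilinear_comp (k : fieldType) (U U' V V' W : lmodType k)
    (f : U -> V -> W) (P : U' -> U) (Q : V' -> V) :
  is_bilinear f -> linear P -> linear Q ->
  is_bilinear (fun u v => f (P u) (Q v)).
Proof.
move=> [fl fr] linP linQ; split=> [v a u u' | u a v v'] /=.
- by rewrite linP fl.
- by rewrite linQ fr.
Qed.

Lemma bilinearDl (k : fieldType) (U V W : lmodType k) (f : U -> V -> W) :
  is_bilinear f -> forall u u' v, f (u + u') v = f u v + f u' v.
Proof.
by move=> [fl _] u u' v; have := fl v 1 u u'; rewrite /= !scale1r.
Qed.

Lemma bilinearBl (k : fieldType) (U V W : lmodType k) (f : U -> V -> W) :
  is_bilinear f -> forall u u' v, f (u - u') v = f u v - f u' v.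
Proof.
move=> [fl _] u u' v; have := fl v (-1) u' u.
by rewrite /= !scaleN1r [- u' + u]addrC [- f u' v + _]addrC.
Qed.

Lemma bilinearDr (k : fieldType) (U V W : lmodType k) (f : U -> V -> W) :
  is_bilinear f -> forall u v v', f u (v + v') = f u v + f u v'.
Proof.
by move=> [_ fr] u v v'; have := fr u 1 v v'; rewrite /= !scale1r.
Qed.

(** Polarization: expand f (x + y) (x + y) = 0. *)
Lemma alternating_skew (k : fieldType) (U W : lmodType k) (f : U -> U -> W) :
  is_bilinear f -> (forall x, f x x = 0) -> forall x y, f x y = - f y x.
Proof.
move=> fbil f0 x y; apply/eqP; rewrite -addr_eq0; apply/eqP.
have := f0 (x + y).
by rewrite (bilinearDl fbil) !(bilinearDr fbil) !f0 add0r addr0.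
Qed.

(** If the bracket acts by commutators, the first NS-Lie axiom is what remains
    after expanding the left slot of [dia] at the bracket. *)
Lemma rep_bracket_dia_dia (k : fieldType) (B : lmodType k)
    (dia bul : B -> B -> B) :
  is_bilinear dia ->
  (forall x y z,
    dia (ns_bracket dia bul x y) z = dia x (dia y z) - dia y (dia x z)) ->
  forall x y z,
    dia x (dia y z) - dia (dia x y) z - dia y (dia x z) + dia (dia y x) z
      = dia (bul x y) z.
Proof.
move=> dbil dbr x y z; have := dbr x y z.
rewrite /ns_bracket (bilinearDl dbil) (bilinearBl dbil) => E.
rewrite [_ - dia (dia x y) z - _]addrAC -E [_ - dia (dia x y) z + _]addrAC.
by rewrite [_ + _ + dia (dia y x) z]addrAC subrK addrAC subrr add0r.
Qed.

Theorem theorem3p11 (k : fieldType) (char_k : [pchar k] =i pred0)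
    (A V : lmodType k) (mul br : A -> A -> A) (mu rho : A -> V -> V)
    (h H : A -> A -> V) (R : V -> A)
    (hA : poisson_algebra mul br)
    (hV : poisson_representation mul br mu rho)
    (hhH : poisson_2cocycle mul br mu rho h H)
    (hR : twisted_rota_baxter mul br mu rho h H R) :
  ns_poisson_algebra
    (fun u v : V => mu (R u) v)
    (fun u v : V => h (R u) (R v))
    (fun u v : V => rho (R u) v)
    (fun u v : V => H (R u) (R v)).
Proof.
case: hV => [[mubil muM] [rhobil rhoB] compatB compatM].
case: hhH => hbil Hbil Halt hsym hcoc Hcoc hHcoc.
case: hR => linR RM RB.
have odotE u v : R (ns_odot (fun u v => mu (R u) v)
    (fun u v => h (R u) (R v)) u v) = mul (R u) (R v) by rewrite RM.
have bracketE u v : R (ns_bracket (fun u v => rho (R u) v)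
    (fun u v => H (R u) (R v)) u v) = br (R u) (R v) by rewrite RB.
have linid : linear (@id V) by [].
have diabil := is_bilinear_comp rhobil linR linid.
split.
- split.
  + exact: (is_bilinear_comp mubil linR linid).
  + exact: (is_bilinear_comp hbil linR linR).
  + by move=> x y; apply: hsym.
  + by move=> x y z; rewrite odotE muM.
  + by move=> x y z; rewrite !odotE hcoc.
- split.
  + exact: diabil.
  + exact: (is_bilinear_comp Hbil linR linR).
  + by move=> x y; apply: (alternating_skew Hbil).
  + apply: (rep_bracket_dia_dia diabil (bul := fun u v => H (R u) (R v))).
    by move=> x y z; rewrite bracketE rhoB.
  + move=> x y z; rewrite !bracketE -(Hcoc (R x) (R y) (R z)).
    by rewrite -[LHS]addrA -[LHS]addrA [LHS]addrC !addrA.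
- move=> x y z; rewrite bracketE.
  by apply/esym/eqP; rewrite -subr_eq0 compatB.
- move=> x y z; rewrite odotE.
  by apply/esym/eqP; rewrite -subr_eq0 compatM.
- by move=> x y z; rewrite odotE !bracketE hHcoc.
Qed.
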